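(* Let $n$ be a positive integer and let $a,b\in\{0,1,2\}$ with $b-a\equiv 1 \pmod 3$. Let $\mathcal{F}\subseteq\mathscr{P}(n)$ be an $(a,b)$-town$\pmod 3$. Suppose that one of the following holds: (1) $n\equiv 2\pmod 3$; (2) $n\equiv 0\pmod 3$ and $a=0$, $b=1$. Then $|\mathcal{F}|\leq n-1$.
   Context: $[n]=\{1,2,\ldots,n\}$ and $\mathscr{P}(n)$ is the power set of $[n]$; a family $\mathcal{F}\subseteq\mathscr{P}(n)$ is a set of (distinct) subsets of $[n]$. For integers $k\ge 2$ and $0\le a,b\le k-1$, a family $\mathcal{F}\subseteq\mathscr{P}(n)$ is an $(a,b)$-town$\pmod k$ if for any distinct $A,B\in\mathcal{F}$ we have $|A|\equiv a\pmod k$ and $|A\cap B|\equiv b\pmod k$; that is, every set in $\mathcal{F}$ has cardinality $\equiv a\pmod k$ and every intersection of two distinct sets of $\mathcal{F}$ has cardinality $\equiv b\pmod k$. *)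

(* Defs.v *)
From mathcomp Require Export all_boot all_order all_algebra.
Set Implicit Arguments.
Unset Strict Implicit.
Unset Printing Implicit Defensive.

(* The ground set [n] is 'I_n.  The size condition is imposed on every member
   of F, including the only member of a one-element family, for which a
   quantification over distinct pairs would be vacuous. *)
Definition town_mod (k a b n : nat) (F : {set {set 'I_n}}) : Prop :=
  (forall A : {set 'I_n}, A \in F -> #|A| = a %[mod k]) /\
  (forall A B : {set 'I_n}, A \in F -> B \in F -> A <> B ->
     #|A :&: B| = b %[mod k]).

(* Main.v *)
Require Import Defs.
From mathcomp Require Import all_boot all_order all_algebra.
From mathcomp Require Import zify ring.
Import GRing.Theory.

(** If F had at least n members, choose n of them and work over the field with
    three elements.  Their n incidence vectors together with the all-ones vector
    are n + 1 vectors in a space of dimension n, so they satisfy a nontrivial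
    linear relation.  Pairing the relation with each incidence vector shows that
    all coefficients of incidence vectors are equal, and pairing it with the
    all-ones vector then forces n b - 1 - a^2 = 0, which fails in each case. *)

Local Open Scope ring_scope.

Lemma row_dependence (K : fieldType) (m n : nat) (N : 'M[K]_(m, n)) :
  (n < m)%N -> exists2 u : 'rV[K]_m, u != 0 & u *m N = 0.
Proof.
move=> lt_nm; have: kermx N != 0.
  rewrite kermx_eq0 /row_free; apply: contraTneq lt_nm => <-.
  by rewrite -leqNgt rank_leq_col.
by case/rowV0Pn=> u /sub_kermxP uN0 u_neq0; exists u.
Qed.

(** The Gram matrix [b J - I] encodes a town with [a = b - 1]: the diagonal entries are set sizes. A
    relation has common row coefficient [g] and all-ones coefficient [d]; eliminating [d] leaves
    [(n b - 1 - a^2) g = 0]. *)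
Lemma square_gram_degenerate (K : fieldType) (n : nat) (M : 'M[K]_n) (a b : K) :
    (0 < n)%N ->
    (forall i k, \sum_j M i j * M k j = b - (i == k)%:R) ->
    (forall i, \sum_j M i j = a) ->
    n%:R != 0 :> K \/ a = 0 ->
  n%:R * b - 1 - a ^+ 2 = 0.
Proof.
move=> n_gt0 gramM sumM na; apply/eqP/negPn/negP => det_neq0.
have [u u_neq0 uN0] : exists2 u : 'rV[K]_(n + 1), u != 0 &
    u *m col_mx M (const_mx 1) = 0 by apply: row_dependence; rewrite addn1.
pose c i := u 0 (lshift 1 i); pose d := u 0 (rshift n 0).
have rel j : \sum_i c i * M i j + d = 0.
  move/matrixP/(_ 0 j): uN0; rewrite !mxE big_split_ord /= big_ord1 => E.
  rewrite -[RHS]E col_mxEd mxE mulr1; congr (_ + _).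
  by apply: eq_bigr => i _; rewrite col_mxEu.
pose S := \sum_i c i.
(* Pairing with row [k] gives [b * S - c k + a * d = 0], whose only dependence on [k] is through
   [c k]. *)
have cE k : c k = b * S + a * d.
  have: \sum_j (\sum_i c i * M i j + d) * M k j = 0.
    by apply: big1 => j _; rewrite rel mul0r.
  under eq_bigr do rewrite mulrDl mulr_suml.
  rewrite big_split /= exchange_big -mulr_sumr sumM /=.
  under eq_bigr => i _.
    under eq_bigr do rewrite -mulrA.
    rewrite -mulr_sumr gramM mulrBr.
    over.
  rewrite sumrB -mulr_suml -/S (bigD1 k) //= eqxx mulr1 big1 ?addr0.
    by move=> E; apply/eqP; rewrite -subr_eq0 -oppr_eq0 -[X in _ == X]E; apply/eqP; ring.
  by move=> i /negPf ->; rewrite mulr0.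
have SE : S = n%:R * (b * S + a * d).
  by rewrite {1}/S (eq_bigr _ (fun i _ => cE i)) sumr_const card_ord mulr_natl.
have sum_rel : a * S + n%:R * d = 0.
  have: \sum_j (\sum_i c i * M i j + d) = 0 by apply: big1 => j _; rewrite rel.
  rewrite big_split /= exchange_big sumr_const card_ord /= => E.
  rewrite -[RHS]E mulr_natl mulrC mulr_suml; congr (_ + _).
  by apply: eq_bigr => i _; rewrite -mulr_sumr sumM.
pose g := b * S + a * d; rewrite -/g in SE cE.
(* With [S = n g], [sum_rel] reads [n (a g + d) = 0]: cancel [n] if it is nonzero; if [a = 0], both
   sides vanish. *)
have ad : a * d = - a ^+ 2 * g.
  case: na => [n_neq0 | ->]; last by rewrite expr0n /= oppr0 !mul0r.
  apply: (mulfI n_neq0); move: sum_rel; rewrite SE => E.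
  by apply/eqP; rewrite -subr_eq0 -(mulr0 a) -E; apply/eqP; ring.
have g0 : g = 0.
  apply: (mulfI det_neq0); rewrite mulr0 mulrBl mulrBl mul1r.
  have -> : n%:R * b * g = b * S by rewrite SE; ring.
  by rewrite -mulNr -ad {1}/g; ring.
have c0 i : c i = 0 by rewrite cE.
(* Since [n > 0] there is a column, where the relation reduces to [d = 0]. *)
have d0 : d = 0.
  have := rel (Ordinal n_gt0).
  by rewrite big1 ?add0r // => i _; rewrite c0 mul0r.
case/eqP: u_neq0; apply/rowP => i; rewrite mxE.
by case: (split_ordP i) => [j | j] ->; [apply: c0 | rewrite (ord1 j); apply: d0].
Qed.

Lemma sum_mem_natr (R : pzSemiRingType) (T : finType) (A : {set T}) :
  \sum_x (x \in A)%:R = #|A|%:R :> R.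
Proof. by rewrite -natr_sum -sum1_card [in RHS]big_mkcond. Qed.

Lemma sum_mem2_natr (R : pzSemiRingType) (T : finType) (A B : {set T}) :
  \sum_x (x \in A)%:R * (x \in B)%:R = #|A :&: B|%:R :> R.
Proof.
by rewrite -sum_mem_natr; apply: eq_bigr => x _; rewrite inE -natrM mulnb.
Qed.

Lemma natr_F3_eq {m p : nat} : (m = p %[mod 3])%N -> m%:R = p%:R :> 'F_3.
Proof. by move=> E; rewrite -[m%:R]Zp_nat_mod // E Zp_nat_mod. Qed.

Local Close Scope ring_scope.

Theorem proposition1p3 (n a b : nat) (n_gt0 : 0 < n)
    (a_lt3 : a < 3) (b_lt3 : b < 3)
    (hab : (b%:Z - a%:Z = 1 %[mod 3])%Z)
    (F : {set {set 'I_n}}) (hF : town_mod 3 a b F)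
    (hn : n = 2 %[mod 3] \/ (n = 0 %[mod 3] /\ a = 0 /\ b = 1)) :
  #|F| <= n - 1.
Proof.
case: hF => sizeF interF; rewrite leqNgt; apply/negP => lt_nF.
have le_nF : n <= #|F| by lia.
pose s (i : 'I_n) : {set 'I_n} := enum_val (widen_ord le_nF i).
have sF i : s i \in F by apply: enum_valP.
have s_inj : injective s.
  by move=> i k /enum_val_inj /(congr1 val) /= /val_inj.
have ab3 : b = a.+1 %[mod 3] by lia.
have abF : (a%:R = b%:R - 1 :> 'F_3)%R.
  by rewrite (natr_F3_eq ab3) -natr1 addrK.
pose M : 'M['F_3]_n := (\matrix_(i, j) (j \in s i)%:R)%R.
have : (n%:R * b%:R - 1 - a%:R ^+ 2 = 0 :> 'F_3)%R.
  apply: (square_gram_degenerate _ _ M) => // [i k | i |].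
  - under eq_bigr do rewrite !mxE.
    rewrite sum_mem2_natr; have [<- | /eqP neq_ik] := eqVneq i k.
      by rewrite setIid (natr_F3_eq (sizeF _ (sF i))).
    by rewrite subr0; apply/natr_F3_eq/interF => // /s_inj.
  - under eq_bigr do rewrite mxE.
    by rewrite sum_mem_natr (natr_F3_eq (sizeF _ (sF i))).
  - case: hn => [n2 | [_ [-> _]]]; last by right.
    by left; rewrite (natr_F3_eq n2).
(* For [n = 0] the value is [-1]. For [n = 2] the pairs (0,1), (1,2), (2,0) give 1, 2, 1 in
   ['F_3]. *)
have [n3 | [n3 [a0 b1]]] := hn; rewrite (natr_F3_eq n3); last by rewrite a0 b1.
have: [|| (a == 0) && (b == 1), (a == 1) && (b == 2) | (a == 2) && (b == 0)].
  by lia.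
by case/or3P => /andP[/eqP-> /eqP->].
Qed.
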